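(* Let $k$ be an algebraically closed field of characteristic $p>0$, let $\mathfrak{e}_r$ be the $r$-dimensional elementary restricted Lie algebra over $k$, and let $M$ be a finite-dimensional $\mathrm{GL}_r(k)$-stable $U_0(\mathfrak{e}_r)$-module. If $j\in\{1,\ldots,p-1\}$ is such that the morphism $\mathrm{im}^j_M:\mathbb{P}(\mathfrak{e}_r)\to\mathrm{Gr}_{\mathrm{rk}^j(M)}(M)$, $[x]\mapsto\mathrm{im}\,x_M^j$, is not constant, then $\mathrm{im}^j_M$ is injective.
   Context: $\mathfrak{e}_r$ is the $r$-dimensional abelian Lie algebra with zero $p$-map; its restricted enveloping algebra is $U_0(\mathfrak{e}_r)\cong k[X_1,\ldots,X_r]/(X_1^p,\ldots,X_r^p)$. $\mathrm{GL}_r(k)=\mathrm{GL}(\mathfrak{e}_r)$ acts on $\mathfrak{e}_r$ by automorphisms of restricted Lie algebras and hence on $U_0(\mathfrak{e}_r)$ by automorphisms of Hopf algebras. For a $U_0(\mathfrak{e}_r)$-module $M$ and $g\in\mathrm{GL}_r(k)$, $M^{(g)}$ is the module with underlying space $M$ and action $u.m:=(g^{-1}.u)m$; $M$ is $\mathrm{GL}_r(k)$-stable if $M^{(g)}\cong M$ for all $g\in\mathrm{GL}_r(k)$. For $x\in\mathfrak{e}_r$, $x_M$ is the operator $m\mapsto x.m$. A $\mathrm{GL}_r(k)$-stable module has constant $j$-rank, i.e. $\mathrm{rk}(x_M^j)$ has the same value, denoted $\mathrm{rk}^j(M)$, for all $x\in\mathfrak{e}_r\setminus\{0\}$, so $\mathrm{im}^j_M$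 is defined on all of $\mathbb{P}(\mathfrak{e}_r)$; it takes values in the Grassmannian of $\mathrm{rk}^j(M)$-dimensional subspaces of $M$. *)

(* Defs.v *)
From HB Require Import structures.
From mathcomp Require Import all_boot all_order all_algebra.
From mathcomp Require Import mpoly.

Set Implicit Arguments.
Unset Strict Implicit.
Unset Printing Implicit Defensive.

Import GRing.Theory.
Local Open Scope ring_scope.
Local Open Scope quotient_scope.

Section TruncatedIdeal.

Variables (k : fieldType) (p : nat) (hp : p \in [pchar k]) (r : nat).

(* Ring quotients need a decidable ideal. This is the ideal generated by the
   X_i ^+ p, as truncIP proves. The argument hp ensures that 1 is not in it. *)
Definition truncI of p \in [pchar k] : {pred {mpoly k[r]}} :=
  fun f => all (fun m : 'X_{1..r} => [exists i, (p <= m i)%N]) (msupp f).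

Local Notation I := (truncI hp).

Lemma truncI_coef f :
  reflect (forall m, f@_m != 0 -> exists i, (p <= m i)%N) (f \in I).
Proof.
apply: (iffP allP) => H m.
  by rewrite -mcoeff_msupp => /H /existsP.
by rewrite mcoeff_msupp => /H /existsP.
Qed.

Lemma truncI_zmod : zmod_closed I.
Proof.
split=> [|f g /truncI_coef Hf /truncI_coef Hg].
  by apply/truncI_coef => m; rewrite mcoeff0 eqxx.
apply/truncI_coef => m; rewrite mcoeffB.
have [/eqP f0|fN0 _] := boolP (f@_m == 0); last exact: Hf.
by rewrite f0 sub0r oppr_eq0; exact: Hg.
Qed.

Lemma truncI_proper :
  1 \notin I /\ forall a, {in I, forall u, a * u \in I}.
Proof.
split=> [|f g /allP Hg].
  apply/negP => /truncI_coef /(_ 0%MM).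
  rewrite mcoeff1 eqxx oner_eq0 => /(_ isT) [i].
  by rewrite mnm0E leqNgt prime_gt0 // (pcharf_prime hp).
apply/allP => m /msuppM_le /allpairsP [[m1 m2] /= [_ m2g ->]].
have /existsP [i pi] := Hg _ m2g.
by apply/existsP; exists i; rewrite mnmDE (leq_trans pi) ?leq_addl.
Qed.

HB.instance Definition _ := GRing.isZmodClosed.Build {mpoly k[r]} I truncI_zmod.
HB.instance Definition _ := isProperIdeal.Build {mpoly k[r]} I truncI_proper.

Lemma truncI_XnM (h : {mpoly k[r]}) i : h * 'X_i ^+ p \in I.
Proof.
apply: idealMr; apply/truncI_coef => m.
rewrite mpolyXn mcoeffX; case: (_ =P m) => [<- _|_]; last by rewrite eqxx.
by exists i; rewrite mulmnE mnm1E eqxx mul1n.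
Qed.

Lemma truncIP f :
  reflect (exists h : 'I_r -> {mpoly k[r]}, f = \sum_(i < r) h i * 'X_i ^+ p)
          (f \in I).
Proof.
apply: (iffP idP) => [/allP Hf|[h ->]]; last first.
  by apply: rpred_sum => i _; exact: truncI_XnM.
rewrite (mpolyE f) big_seq; elim/big_ind: _ => [|_ _ [h ->] [h' ->]|m mf].
- by exists (fun _ => 0); rewrite big1 // => i _; rewrite mul0r.
- exists (fun i => h i + h' i); rewrite -big_split /=.
  by apply: eq_bigr => i _; rewrite mulrDl.
- have /existsP [i pi] := Hf _ mf.
  exists (fun j => if j == i then f@_m *: 'X_[m - U_(i) *+ p] else 0).
  rewrite (bigD1 i) //= eqxx big1 ?addr0 => [|j /negPf->]; last by rewrite mul0r.
  rewrite -scalerAl mpolyXn -mpolyXD submK //.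
  apply/mnm_lepP => j; rewrite mulmnE mnm1E.
  by case: eqP => [<-|]; rewrite ?mul1n.
Qed.

End TruncatedIdeal.

Section RestrictedEnvelopingAlgebra.

Variables (k : fieldType) (p : nat) (hp : p \in [pchar k]) (r : nat).

Local Notation poly := {mpoly k[r]}.

(* U_0(e_r) = k[X_1, ..., X_r] / (X_1 ^+ p, ..., X_r ^+ p), where e_r is the
   space of column vectors 'cV[k]_r. *)
Definition U0 : Type := {ideal_quot (truncI hp : {pred poly})}.

HB.instance Definition _ := GRing.ComNzRing.on U0.

Definition U0_pi (f : poly) : U0 := \pi_({ideal_quot truncI hp : {pred poly}}) f.
HB.instance Definition _ := GRing.RMorphism.copy U0_pi
  (\pi_({ideal_quot truncI hp : {pred poly}})).

Definition U0_repr (u : U0) : poly := repr (u : {ideal_quot truncI hp : {pred poly}}).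

Lemma U0_reprK : cancel U0_repr U0_pi.
Proof. exact: reprK. Qed.

Lemma U0_pi_eq (f g : poly) : U0_pi f = U0_pi g <-> f - g \in truncI hp.
Proof. by split=> [/eqP|H]; [|apply/eqP]; rewrite -Quotient.idealrBE. Qed.

Lemma U0_pi_eq0 (f : poly) : U0_pi f = 0 <-> f \in truncI hp.
Proof. by rewrite -(rmorph0 U0_pi) U0_pi_eq subr0. Qed.

Lemma U0_surj (u : U0) : exists f, u = U0_pi f.
Proof. by exists (U0_repr u); rewrite U0_reprK. Qed.

Definition U0_scale (a : k) (u : U0) : U0 := U0_pi a%:MP * u.

Lemma U0_scaleA a b u : U0_scale a (U0_scale b u) = U0_scale (a * b) u.
Proof. by rewrite /U0_scale mpolyCM rmorphM mulrA. Qed.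

Lemma U0_scale1 : left_id 1 U0_scale.
Proof. by move=> u; rewrite /U0_scale rmorph1 mul1r. Qed.

Lemma U0_scaleDr : right_distributive U0_scale +%R.
Proof. by move=> a u v; rewrite /U0_scale mulrDr. Qed.

Lemma U0_scaleDl u : {morph U0_scale^~ u : a b / a + b}.
Proof. by move=> a b; rewrite /U0_scale mpolyCD rmorphD mulrDl. Qed.

HB.instance Definition _ := GRing.Zmodule_isLmodule.Build k U0
  U0_scaleA U0_scale1 U0_scaleDr U0_scaleDl.

Lemma U0_scaleAl (a : k) (u v : U0) : a *: (u * v) = (a *: u) * v.
Proof. exact: mulrA. Qed.

HB.instance Definition _ := GRing.Lmodule_isLalgebra.Build k U0 U0_scaleAl.
HB.instance Definition _ := GRing.Lalgebra_isComAlgebra.Build k U0.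

Lemma U0_pi_scalable : scalable U0_pi.
Proof. by move=> a f; rewrite -mul_mpolyC rmorphM. Qed.

HB.instance Definition _ := GRing.isScalable.Build k poly U0 *:%R U0_pi U0_pi_scalable.

(* The inclusion of e_r in U_0(e_r); the i-th basis vector is sent to X_i. *)
Definition U0_iota (x : 'cV[k]_r) : U0 := \sum_(i < r) x i 0 *: U0_pi 'X_i.

Lemma U0_iota_is_linear : linear U0_iota.
Proof.
move=> a x y; rewrite /U0_iota scaler_sumr -big_split /=.
by apply: eq_bigr => i _; rewrite !mxE scalerDl scalerA.
Qed.

HB.instance Definition _ := GRing.isLinear.Build k 'cV[k]_r U0 *:%R U0_iota
  U0_iota_is_linear.

(* The algebra endomorphism extending x |-> g *m x on e_r, that is,
   X_i |-> \sum_j g j i X_j. *)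
Definition U0_subst (g : 'M[k]_r) : poly -> poly :=
  comp_mpoly [tuple \sum_(j < r) g j i *: 'X_j | i < r].
HB.instance Definition _ (g : 'M[k]_r) := GRing.LRMorphism.on (U0_subst g).

Definition U0_gl (g : 'M[k]_r) (u : U0) : U0 := U0_pi (U0_subst g (U0_repr u)).

Lemma U0_subst_truncI g f : f \in truncI hp -> U0_subst g f \in truncI hp.
Proof.
case/truncIP => h ->; rewrite rmorph_sum rpred_sum // => i _.
rewrite rmorphM rmorphXn /= /U0_subst comp_mpolyXU -tnth_nth tnth_mktuple.
have pm : p \in [pchar poly] := rmorph_pchar (@mpolyC r k) hp.
rewrite -(pFrobenius_autE pm) rmorph_sum /= mulr_sumr rpred_sum // => j _.
by rewrite pFrobenius_autE exprZn -scalerAr scalerAl truncI_XnM.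
Qed.

Lemma U0_gl_pi g f : U0_gl g (U0_pi f) = U0_pi (U0_subst g f).
Proof.
apply/U0_pi_eq; rewrite -rmorphB; apply: U0_subst_truncI.
by apply/U0_pi_eq; rewrite U0_reprK.
Qed.

Lemma U0_gl_is_linear g : linear (U0_gl g).
Proof.
move=> a u v; have [[f ->] [h ->]] := (U0_surj u, U0_surj v).
by rewrite -linearP !U0_gl_pi !linearP.
Qed.

Lemma U0_gl_is_monoid_morphism g : monoid_morphism (U0_gl g).
Proof.
split=> [|u v]; first by rewrite -(rmorph1 U0_pi) U0_gl_pi !rmorph1.
have [[f ->] [h ->]] := (U0_surj u, U0_surj v).
by rewrite -rmorphM !U0_gl_pi !rmorphM.
Qed.

HB.instance Definition _ g := GRing.isLinear.Build k U0 U0 *:%R (U0_gl g)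
  (U0_gl_is_linear g).
HB.instance Definition _ g := GRing.isMonoidMorphism.Build U0 U0 (U0_gl g)
  (U0_gl_is_monoid_morphism g).

Lemma U0_gl_iota g x : U0_gl g (U0_iota x) = U0_iota (g *m x).
Proof.
rewrite /U0_iota linear_sum /=.
under eq_bigr => i _ do rewrite linearZ /= U0_gl_pi /U0_subst comp_mpolyXU
  -tnth_nth tnth_mktuple linear_sum scaler_sumr.
rewrite exchange_big; apply: eq_bigr => j _ /=.
rewrite mxE scaler_suml; apply: eq_bigr => i _.
by rewrite linearZ scalerA mulrC.
Qed.

(* A finite-dimensional module, as an algebra morphism U_0(e_r) -> End_k(V).
   'End(V) carries no canonical ring structure because V may be 0, hence the
   explicit axioms. *)
Record U0mod : Type := U0Mod {
  U0mod_space :> vectType k;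
  U0mod_act : {linear U0 -> 'End(U0mod_space)};
  U0mod_act1 : U0mod_act 1 = \1%VF;
  U0mod_actM : forall u v : U0,
    U0mod_act (u * v) = (U0mod_act u \o U0mod_act v)%VF }.

Definition U0mod_iso (M N : U0mod) : Prop :=
  exists2 f : {linear M -> N}, bijective f &
    forall (u : U0) (m : M), f (U0mod_act M u m) = U0mod_act N u (f m).

Section Twist.

Variables (g : 'M[k]_r) (M : U0mod).

Let act : {linear U0 -> 'End(M)} := U0mod_act M \o U0_gl (invmx g).

Let act1 : act 1 = \1%VF.
Proof. by rewrite /act /= rmorph1 U0mod_act1. Qed.

Let actM u v : act (u * v) = (act u \o act v)%VF.
Proof. by rewrite /act /= rmorphM U0mod_actM. Qed.

(* M^(g), meaningful for g \in unitmx: u acts as g^-1 . u does on M. *)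
Definition U0mod_twist : U0mod := U0Mod act1 actM.

End Twist.

Definition GL_stable (M : U0mod) : Prop :=
  forall g : 'M[k]_r, g \in unitmx -> U0mod_iso (U0mod_twist g M) M.

Definition x_op (M : U0mod) (x : 'cV[k]_r) : 'End(M) := U0mod_act M (U0_iota x).

Definition x_op_pow (M : U0mod) (x : 'cV[k]_r) (j : nat) : 'End(M) :=
  iter j (comp_lfun (x_op M x)) \1%VF.

Lemma x_op_powE M x j : x_op_pow M x j = U0mod_act M (U0_iota x ^+ j).
Proof.
elim: j => [|j IHj]; first by rewrite expr0 U0mod_act1.
by rewrite exprS U0mod_actM -IHj.
Qed.

(* rk^j(M), read off at an arbitrary nonzero vector (at 0 if r = 0); by
   const_jrank the choice does not matter when M is GL_r(k)-stable. *)
Definition jrank (M : U0mod) (j : nat) : nat :=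
  \dim (limg (x_op_pow M (vpick fullv) j)).

Lemma GL_transitive (x y : 'cV[k]_r) :
  x != 0 -> y != 0 -> exists2 g : 'M[k]_r, g \in unitmx & y = g *m x.
Proof.
move=> x0 y0; have tr0 (z : 'cV[k]_r) : z != 0 -> \rank z^T = 1%N.
  by move=> z0; rewrite rank_rV -(inj_eq trmx_inj) trmxK trmx0 z0.
have fx : y^T = x^T *m (pinvmx x^T *m y^T).
  rewrite mulmxA; suff -> : x^T *m pinvmx x^T = 1%:M by rewrite mul1mx.
  by apply: mulmxVp; rewrite /row_free tr0.
have [|g gU E] := @complete_unitmx _ _ _ x^T (pinvmx x^T *m y^T).
  by rewrite -fx !tr0.
exists g^T; first by rewrite unitmx_tr.
by apply: trmx_inj; rewrite trmx_mul trmxK fx.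
Qed.

Lemma const_jrank M j x :
  GL_stable M -> x != 0 -> \dim (limg (x_op_pow M x j)) = jrank M j.
Proof.
move=> stM x0; rewrite /jrank; set y := vpick _.
have y0 : y != 0.
  by rewrite vpick0; apply: contraNneq x0 => V0; rewrite -memv0 -V0 memvf.
have [g gU ->] := GL_transitive y0 x0.
have [f [f' fK f'K] fE] := stM g gU.
pose F : 'End(M) := linfun f.
have FE m : F m = f m by rewrite lfunE.
have kF : lker F == 0%VS.
  by apply/lker0P => m m'; rewrite !FE => /(can_inj fK).
have imF : limg F = fullv.
  apply/eqP; rewrite eqEsubv subvf; apply/subvP => m _.
  by rewrite -[m]f'K -FE memv_img ?memvf.
have FC : (F \o x_op_pow M y j = x_op_pow M (g *m y) j \o F)%VF.
  apply/lfunP => m; rewrite !comp_lfunE /= !FE !x_op_powE -fE /=.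
  by rewrite rmorphXn /= U0_gl_iota mulmxA mulVmx // mul1mx.
rewrite -[in LHS]imF -limg_comp -FC limg_comp limg_dim_eq //.
by move/eqP: kF => ->; rewrite capv0.
Qed.

End RestrictedEnvelopingAlgebra.

(* Gr_d(V) and P(V) are given by their sets of closed points only. *)
Definition Gr (k : fieldType) (d : nat) (V : vectType k) : Type :=
  {W : {vspace V} | \dim W == d}.

Definition Proj (k : fieldType) (V : vectType k) : Type := Gr 1 V.

Section ImageMap.

Variables (k : fieldType) (p : nat) (hp : p \in [pchar k]) (r : nat).
Variables (M : U0mod hp r) (stM : GL_stable M) (j : nat).

Definition Proj_pt (x : 'cV[k]_r) (x0 : x != 0) : Proj 'cV[k]_r.
Proof. by exists <[x]>%VS; rewrite dim_vline x0. Defined.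

Lemma Proj_vpick_neq0 (L : Proj 'cV[k]_r) : vpick (val L) != 0.
Proof. by case: L => L /= /eqP dL; rewrite vpick0 -dimv_eq0 dL. Qed.

(* im^j_M : [x] |-> im x_M^j. It is computed at the representative vpick of a
   line; im_mapE shows that every representative gives the same value. *)
Definition im_map (L : Proj 'cV[k]_r) : Gr (jrank M j) M :=
  exist _ (limg (x_op_pow M (vpick (val L)) j))
    (introT eqP (const_jrank j stM (Proj_vpick_neq0 L))).

Lemma im_mapE x (x0 : x != 0) :
  val (im_map (Proj_pt x0)) = limg (x_op_pow M x j).
Proof.
rewrite /=; set y := vpick _.
have y0 : y != 0 by rewrite vpick0 -dimv_eq0 dim_vline x0.
have /vlineP [a ya] : y \in <[x]>%VS by exact: memv_pick.
have a0 : a != 0 by apply: contraNneq y0 => a0; rewrite ya a0 scale0r.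
rewrite ya !x_op_powE linearZ exprZn linearZ; set h := U0mod_act _ _.
have c0 : a ^+ j != 0 by rewrite expf_neq0.
apply/vspaceP => w; apply/memv_imgP/memv_imgP => [] [v _ ->].
  by exists (a ^+ j *: v); rewrite ?memvf // scale_lfunE linearZ.
exists ((a ^+ j)^-1 *: v); rewrite ?memvf // scale_lfunE linearZ scalerA.
by rewrite divff // scale1r.
Qed.

End ImageMap.

(* Main.v *)
Require Import Defs.
From mathcomp Require Import all_boot all_order all_algebra.

Import GRing.Theory.
Local Open Scope ring_scope.

(** Stability provides, for each [g] in [GL_r(k)], an automorphism of [M]
    carrying [im x_M^j] onto [im (g x)_M^j]. Hence "having the same image under
    [im^j_M]" is a [GL_r(k)]-invariant equivalence relation on [P(e_r)]. Since
    [GL_r(k)] is doubly transitive on [P(e_r)], such a relation is either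
    equality or the total relation. *)

Lemma row_free_transitive (k : fieldType) (n r : nat) (A B : 'M[k]_(n, r)) :
  row_free A -> row_free B -> exists2 g : 'M[k]_r, g \in unitmx & B = A *m g.
Proof.
move=> fA fB; have BE : B = A *m (pinvmx A *m B).
  by rewrite mulmxA mulmxVp // mul1mx.
have [|g gU E] := @complete_unitmx _ _ _ A (pinvmx A *m B).
  by rewrite -BE (eqP fA) (eqP fB).
by exists g => //; rewrite -E.
Qed.

Lemma row_free_pair (k : fieldType) (r : nat) (u v : 'rV[k]_r) :
  u != 0 -> (forall a, v <> a *: u) -> row_free (col_mx u v).
Proof.
move=> u0 vNu; rewrite /row_free eqn_leq rank_leq_row -addsmxE ltnNge.
apply/negP => le1.
have : (u + v <= u)%MS.
  by rewrite -(geq_leqif (mxrank_leqif_sup (addsmxSl u v))) rank_rV u0.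
by rewrite addsmx_sub => /andP [_ /sub_rVP [a]]; exact: vNu.
Qed.

Lemma GL_transitive_pair (k : fieldType) (r : nat) (x y z : 'cV[k]_r) :
    x != 0 -> (forall a, y <> a *: x) -> (forall a, z <> a *: x) ->
  exists2 g : 'M[k]_r, g \in unitmx & g *m x = x /\ g *m y = z.
Proof.
move=> x0 yNx zNx.
have free w : (forall a, w <> a *: x) -> row_free (col_mx x^T w^T).
  move=> wNx; apply: row_free_pair => [|a].
    by apply: contraNneq x0 => xT0; rewrite -[x]trmxK xT0 trmx0.
  by rewrite -linearZ => /trmx_inj; exact: wNx.
have [g gU] := row_free_transitive _ _ _ _ _ (free _ yNx) (free _ zNx).
rewrite mul_col_mx => /eq_col_mx [xE zE].
exists g^T; first by rewrite unitmx_tr.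
by split; apply: trmx_inj; rewrite trmx_mul trmxK.
Qed.

Lemma limg_x_op_pow_GL (k : fieldType) (p : nat) (hp : p \in [pchar k])
    (r : nat) (M : U0mod hp r) (j : nat) (g : 'M[k]_r) :
    GL_stable M -> g \in unitmx ->
  exists F : 'End(M), forall x,
    limg (x_op_pow M (g *m x) j) = (F @: limg (x_op_pow M x j))%VS.
Proof.
move=> stM gU; have [f [f' fK f'K] fE] := stM g gU.
pose F : 'End(M) := linfun f; exists F => x.
have FE m : F m = f m by rewrite lfunE.
have imF : limg F = fullv.
  apply/eqP; rewrite eqEsubv subvf; apply/subvP => m _.
  by rewrite -[m]f'K -FE memv_img ?memvf.
rewrite -limg_comp -[in LHS]imF -limg_comp; congr (limg _).
apply/lfunP => m; rewrite !comp_lfunE /= !FE !x_op_powE -fE /=.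
by rewrite rmorphXn /= U0_gl_iota mulmxA mulVmx // mul1mx.
Qed.

Lemma Proj_eq (k : fieldType) (V : vectType k) (L L' : Proj V) (a : k) :
  vpick (val L') = a *: vpick (val L) -> L' = L.
Proof.
move=> E; apply: val_inj.
have lineE (K : Proj V) : <[vpick (val K)]>%VS = val K.
  case: K => K /= dK; apply/eqP; rewrite eqEdim -memvE memv_pick (eqP dK).
  by rewrite dim_vline vpick0 -dimv_eq0 (eqP dK).
apply/eqP; rewrite eqEdim (eqP (valP L)) (eqP (valP L')) leqnn andbT.
by rewrite -(lineE L') -memvE E memvZ ?memv_pick.
Qed.

Theorem proposition3p2p4 (k : closedFieldType) (p : nat) (hp : p \in [pchar k])
  (r : nat) (M : U0mod hp r) (stM : GL_stable M) (j : nat) (hj : (0 < j < p)%N) :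
  ~ (exists W, forall L, im_map stM j L = W) -> injective (im_map stM j).
Proof.
move=> im_nconst L1 L2 E12; apply/eqP/negPn/negP => /eqP L12.
case: im_nconst; exists (im_map stM j L1) => L.
have [-> // | /eqP LL1] := eqVneq L L1.
have [||g gU [g1 g2]] := GL_transitive_pair k r (vpick (val L1))
  (vpick (val L2)) (vpick (val L)) (Proj_vpick_neq0 L1).
- by move=> a /Proj_eq /esym.
- by move=> a /Proj_eq.
have [F FE] := limg_x_op_pow_GL _ _ _ _ M j g stM gU.
apply: val_inj; have /= {}E12 := congr1 val E12.
by rewrite /= -g2 FE -E12 -FE g1.
Qed.
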